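(* Let $\mu$ be the Gibbs distribution of a $q$-state spin system, with Dobrushin dependency matrix $R$. If the spectral radius of $R$ satisfies $\rho(R)\le1-\epsilon$ for some $\epsilon>0$, then $\mu$ is spectrally independent with constant $\eta=2/\epsilon$.
   Context: Spin system. Let $q\ge2$, $[q]=\{1,\dots,q\}$, and let $G=(V\cup\partial V,E\cup\partial E)$ be a finite graph, where $\partial V$ is a (possibly empty) boundary set, $E$ is the set of edges inside $V$ and $\partial E$ the set of edges between $V$ and $\partial V$. Given nonnegative symmetric matrices $A_{xy}\in\mathbb R_+^{q\times q}$ for $\{x,y\}\in E\cup\partial E$, vectors $B_x\in\mathbb R_+^q$ for $x\in V$, and a boundary condition $\xi\in[q]^{\partial V}$, a configuration $\sigma\in[q]^V$ has weight $w(\sigma)=\prod_{\{x,y\}\in E}A_{xy}(\sigma_x,\sigma_y)\prod_{\{x,y\}\in\partial E,\,x\in V,\,y\in\partial V}A_{xy}(\sigma_x,\xi_y)\prod_{x\in V}B_x(\sigma_x)$. Let $\Omega=\{\sigma:w(\sigma)>0\}$ (assumed nonempty); the Gibbs distribution is $\mu(\sigma)\propto w(\sigma)$ on $\Omega$. Dobrushin dependency matrix: $R\in\mathbb R^{V\times V}$ with $R(x,x)=0$ and, for $x\ne y$, $R(x,y)=\max\{d_{\rm TV}(\mu_y(\cdot\mid\sigma),\mu_y(\cdot\mid\tau)):(\sigma,\tau)\in\mathcal S_{x,y}\}$, where $\mathcal S_{x,y}$ is the set of all pairs of configurations on $V\setminus\{y\}$ that can differ only at $x$, $d_{\rm TV}$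 is total variation distance, and $\mu_y(\cdot\mid\sigma)$ is the conditional distribution of the spin at $y$ given the configuration $\sigma$ on $V\setminus\{y\}$, i.e. the distribution on $[q]$ proportional to $a\mapsto B_y(a)\prod_{z\in V:\{y,z\}\in E}A_{yz}(a,\sigma_z)\prod_{z\in\partial V:\{y,z\}\in\partial E}A_{yz}(a,\xi_z)$ (the maximum is over pairs for which both distributions are defined). Pinnings. For $U\subset V$, $\Omega_U$ is the set of $\tau\in[q]^U$ that extend to an element of $\Omega$; a pinning is an element $\tau\in\bigcup_U\Omega_U$. For $\tau\in\Omega_U$, $\mu^\tau=\mu(\cdot\mid\sigma_U=\tau)$ with support $\Omega^\tau$; $\Omega_x^\tau$ is the set of spins possible at $x$ under $\mu^\tau$; $\mathcal X^\tau=\{(x,a):x\in V\setminus U,a\in\Omega^\tau_x\}$. Standing assumption: $\mu$ is totally-connected, i.e. for every pinning $\tau$ the set $\Omega^\tau$ is connected under moves between configurations at Hamming distance 1. Spectral independence. $J^\tau\in\mathbb R^{\mathcal X^\tau\times\mathcal X^\tau}$ has entries $J^\tau(x,a;x,a')=0$ and $J^\tau(x,a;y,a')=\mu^\tau(\sigma_y=a'\mid\sigma_x=a)-\mu^\tau(\sigma_y=a')$ for $x\neq y$; its eigenvalues are real. $\mu$ is spectrally independent with constant $\eta$ if the largest eigenvalue satisfies $\lambda_1(J^\tau)\le\eta$ for all pinnings $\tau$. *)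

(* Defs.v *)
From mathcomp Require Import all_boot all_order all_algebra.
From mathcomp Require Import boolp classical_sets reals.
From mathcomp Require Import complex.

Set Implicit Arguments.
Unset Strict Implicit.
Unset Printing Implicit Defensive.

Import Order.TTheory GRing.Theory Num.Theory.
Local Open Scope ring_scope.
Local Open Scope complex_scope.

(* The square matrix with rows and columns indexed by the elements of [D],
   in the order of [enum D]. *)
Definition mx_on (R : Type) (T : finType) (D : {set T}) (f : T -> T -> R) :
    'M[R]_#|D| :=
  \matrix_(i < #|D|, j < #|D|) f (enum_val i) (enum_val j).

(* Both suprema below range over finite sets, so they are maxima; they are 0
   for a matrix of size 0. *)

Definition spectral_radius (R : realType) (n : nat) (M : 'M[R]_n) : R :=
  sup [set r : R | exists z : R[i],
         eigenvalue (map_mx (real_complex R) M) z /\ `|z| = r%:C]%classic.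

(* Meant for matrices all of whose complex eigenvalues are real. *)
Definition largest_eigenvalue (R : realType) (n : nat) (M : 'M[R]_n) : R :=
  sup [set r : R | eigenvalue M r]%classic.

(* [V] is the set of vertices and [dV] the boundary set; spins are ['I_q].
   [inter] and [binter] are only meaningful on edges. *)
Record spin_system (R : realType) (q : nat) (V dV : finType) := SpinSystem {
  edge : rel V;
  edge_sym : symmetric edge;
  edge_irr : irreflexive edge;
  bedge : V -> dV -> bool;
  inter : V -> V -> 'M[R]_q;
  interC : forall x y, edge x y -> inter x y = inter y x;
  inter_sym : forall x y, edge x y -> (inter x y)^T = inter x y;
  inter_ge0 : forall x y, edge x y -> forall a b, 0 <= inter x y a b;
  binter : V -> dV -> 'M[R]_q;
  binter_sym : forall x z, bedge x z -> (binter x z)^T = binter x z;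
  binter_ge0 : forall x z, bedge x z -> forall a b, 0 <= binter x z a b;
  ext_field : V -> 'rV[R]_q;
  ext_field_ge0 : forall x a, 0 <= ext_field x 0 a;
  bcond : {ffun dV -> 'I_q}
}.

Definition config (q : nat) (V : finType) := {ffun V -> 'I_q}.

Section Gibbs.
Variables (R : realType) (q : nat) (V dV : finType).
Variable S : spin_system R q V dV.

(* Each unordered edge {x, y} is counted once, oriented by [enum_rank]. *)
Definition weight (s : config q V) : R :=
  (\prod_(e : V * V | edge S e.1 e.2 && (enum_rank e.1 < enum_rank e.2)%N)
      inter S e.1 e.2 (s e.1) (s e.2)) *
  (\prod_(e : V * dV | bedge S e.1 e.2)
      binter S e.1 e.2 (s e.1) (bcond S e.2)) *
  \prod_(x : V) ext_field S x 0 (s x).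

Definition Omega : {set config q V} := [set s | 0 < weight s].

Definition gibbs (s : config q V) : R := weight s / \sum_(t in Omega) weight t.

(* A configuration on V \ {y} is represented by a configuration on V whose
   value at y is irrelevant. *)
Definition local_weight (y : V) (s : config q V) (a : 'I_q) : R :=
  ext_field S y 0 a *
  (\prod_(z : V | edge S y z) inter S y z a (s z)) *
  \prod_(z : dV | bedge S y z) binter S y z a (bcond S z).

Definition local_defined (y : V) (s : config q V) : bool :=
  0 < \sum_(a < q) local_weight y s a.

Definition local_cond (y : V) (s : config q V) (a : 'I_q) : R :=
  local_weight y s a / \sum_(b < q) local_weight y s b.

Definition dTV (p p' : 'I_q -> R) : R := 2^-1 * \sum_(a < q) `|p a - p' a|.

Definition differ_only_at (x y : V) (s t : config q V) : bool :=
  [forall z, (z != x) && (z != y) ==> (s z == t z)].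

Definition dobrushin (x y : V) : R :=
  if x == y then 0
  else \big[Num.max/0]_(st : config q V * config q V
           | [&& differ_only_at x y st.1 st.2,
                 local_defined y st.1 & local_defined y st.2])
         dTV (local_cond y st.1) (local_cond y st.2).

Definition dobrushin_mx : 'M[R]_#|[set: V]| := mx_on [set: V] dobrushin.

End Gibbs.

Section SpectralIndependence.
Variables (R : realType) (q : nat) (V : finType).
Implicit Types (mu : config q V -> R) (A B : pred (config q V)).

Definition prob mu A : R := \sum_(s | A s) mu s.

Definition cond mu B (s : config q V) : R :=
  (if B s then mu s else 0) / prob mu B.

Definition supp mu : {set config q V} := [set s | 0 < mu s].

(* An element of [q]^U is represented by a configuration on V whose values
   outside U are irrelevant. *)
Definition agree_on (U : {set V}) (t s : config q V) : bool :=
  [forall x in U, s x == t x].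

Definition pinning mu (U : {set V}) (t : config q V) : bool :=
  [exists s in supp mu, agree_on U t s].

Definition pinned mu (U : {set V}) (t : config q V) : config q V -> R :=
  cond mu (agree_on U t).

Definition hamming (s t : config q V) : nat := #|[set x | s x != t x]|.

Definition totally_connected mu : Prop :=
  forall (U : {set V}) (t : config q V), pinning mu U t ->
  forall s s', s \in supp (pinned mu U t) ->
    s' \in supp (pinned mu U t) ->
    connect [rel u v | [&& u \in supp (pinned mu U t),
                           v \in supp (pinned mu U t)
                         & hamming u v == 1%N]] s s'.

Definition has_spin (x : V) (a : 'I_q) : pred (config q V) :=
  fun s => s x == a.

Definition site_spins mu (U : {set V}) (t : config q V) :
    {set V * 'I_q} :=
  [set xa | (xa.1 \notin U) && (0 < prob (pinned mu U t) (has_spin xa.1 xa.2))].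

Definition influence mu (U : {set V}) (t : config q V)
    (xa yb : V * 'I_q) : R :=
  let nu := pinned mu U t in
  if xa.1 == yb.1 then 0
  else prob (cond nu (has_spin xa.1 xa.2)) (has_spin yb.1 yb.2)
       - prob nu (has_spin yb.1 yb.2).

Definition influence_mx mu (U : {set V}) (t : config q V) :
    'M[R]_#|site_spins mu U t| :=
  mx_on (site_spins mu U t) (influence mu U t).

Definition spectrally_independent mu (eta : R) : Prop :=
  forall (U : {set V}) (t : config q V), pinning mu U t ->
    largest_eigenvalue (influence_mx mu U t) <= eta.

End SpectralIndependence.

(* Main.v *)
From HB Require Import structures.
Require Import Defs.
From mathcomp Require Import all_boot all_order all_algebra.
From mathcomp Require Import boolp reals complex polyrcf.
From mathcomp Require Import ring lra.
Import Order.TTheory GRing.Theory Num.Theory.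
Local Open Scope ring_scope.

Set Implicit Arguments.
Unset Strict Implicit.
Unset Printing Implicit Defensive.

(** Let [R] be the Dobrushin matrix and [kappa] a number with
    [spectral_radius R < kappa < 1].  As [R] is nonnegative, there are positive site weights [w] with [R w <= kappa w]
    ([positive_weights]).  Put on configurations the Hamming distance weighted
    by [w].

    The heat-bath updates are contracting on average for this distance.  The
    point that needs care is that the total variation distance between the laws
    of the spin at [y] given two feasible configurations [s] and [t] is at most
    the sum of [R x y] over the sites [x != y] where [s] and [t] differ
    ([dTV_le_sum_dobrushin]).  Changing these sites one at a time may lead to
    configurations for which the law of the spin at [y] is not defined.
    Nothing has to be proved if the sum is at least [1].  If it is below [1],
    total connectedness, with all sites pinned except [y] and those where [s]
    and [t] differ, gives a path of feasible configurations from [s] to [t], and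
    along this path all the hybrids of [s] and the current configuration remain
    locally defined at [y] ([hybrid_defined_step]), so that interpolation is
    possible at the end of the path.

    Let [nu] be a pinned Gibbs measure and [g] a [K]-Lipschitz function.  By the
    contraction, the Poisson equation [generator h = g - E_nu g] has a solution
    [h] which is [K / (1 - kappa)]-Lipschitz ([poisson_equation]).  Under [nu]
    conditioned on the spin at [x], all free updates but the one at [x] are
    stationary, hence the mean of [g] moves by at most the mean displacement of
    [h] in an update at [x], which is at most [K / (1 - kappa) * w x]
    ([expect_cond_diff]).

    Finally let [f] be a right eigenvector of the influence matrix for
    [lambda], and let [(x, a)] maximize [|f (x, a)| / w x], the maximum being
    [M].  Then [lambda * f (x, a)] is the difference of the means of
    [g s = sum of f (y, s y) over y != x] under the conditioned measure and under
    [nu], and [g] is [2 M]-Lipschitz.  Hence [lambda <= 2 / (1 - kappa)]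
    ([influence_eigenvalue_le]), and [kappa] can be taken arbitrarily close to
    [1 - eps]. *)

(** * Nonnegative matrices and their spectral radius *)

Lemma seq_max_exists (R : realDomainType) (r : seq R) (x : R) :
  x \in r -> exists2 m, m \in r & forall y, y \in r -> y <= m.
Proof.
elim: r x => // z r IH x _.
case: r IH => [|u r] IH.
  by exists z => [|y]; rewrite ?mem_head // mem_seq1 => /eqP ->.
have [m mr mmax] := IH u (mem_head _ _).
case: (lerP z m) => zm.
  exists m; first by rewrite in_cons mr orbT.
  by move=> y; rewrite in_cons => /orP[/eqP->|/mmax].
exists z; first exact: mem_head.
move=> y; rewrite in_cons => /orP[/eqP->//|/mmax ym].
exact: le_trans ym (ltW zm).
Qed.

Section PositiveWeights.
Variables (R : realType) (n : nat) (M : 'M[R]_n).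

(** The eigenvalue [t] is also an eigenvalue over the complex numbers, and the
    set of moduli is bounded because the characteristic polynomial has finitely
    many roots. *)
Lemma spectral_radius_ge (t : R) :
  eigenvalue M t -> `|t| <= spectral_radius M.
Proof.
move=> Mt; rewrite /spectral_radius; set E := (X in sup X).
have Et : E `|t|.
  exists (real_complex R t); split; last by rewrite normc_def /= expr0n addr0 sqrtr_sqr.
  by rewrite eigenvalue_root_char -map_char_poly fmorph_root
    -eigenvalue_root_char.
apply: sup_upper_bound => //; split; first by exists `|t|.
set p := char_poly (map_mx (real_complex R) M).
have [r pr] := closed_field_poly_normal p.
have p0 : lead_coef p != 0 by rewrite lead_coef_eq0 monic_neq0 // char_poly_monic.
exists (\sum_(z <- r) complex.Re `|z|) => x [z []].
rewrite eigenvalue_root_char -/p pr rootZ // root_prod_XsubC => zr nz.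
have -> : x = complex.Re `|z| by rewrite nz.
rewrite (big_rem z) //= lerDl sumr_ge0 // => y _.
by case: y => a b /=; rewrite sqrtr_ge0.
Qed.

Hypothesis M_ge0 : forall i j, 0 <= M i j.
Variable s : R.
Hypothesis s_gt : spectral_radius M < s.

(** The weights are, up to the factor [chi s], the entries of
    [(s - M)^-1 1].  The entries of [\adj('X - M) 1] are polynomials [N i] with
    [t * N i(t) = (M N)_i(t) + chi(t)]; they are positive for large [t], and
    none vanishes on [[s, +oo[]: at the largest root [t0] of any of them all
    [N j(t0)] are nonnegative, and then the right-hand side is at least
    [chi(t0) > 0]. *)
Lemma positive_weights : exists w : 'I_n -> R,
  (forall i, 0 < w i) /\ forall i, \sum_j M i j * w j <= s * w i.
Proof.
case: (posnP n) => [n0|n_gt0].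
  by exists (fun=> 1); split=> i; have := ltn_ord i; rewrite {2}n0.
pose N := \adj (char_poly_mx M) *m const_mx 1 : 'cV_n.
pose chi := char_poly M.
have Nchi i : (char_poly_mx M *m N) i 0 = chi.
  by rewrite /N mulmxA mul_mx_adj mul_scalar_mx !mxE mulr1.
clearbody N.
have chiE i t : t * (N i 0).[t] = \sum_j M i j * (N j 0).[t] + chi.[t].
  rewrite -(Nchi i) /char_poly_mx mulmxBl mul_scalar_mx !mxE !hornerE horner_sum.
  have -> : \sum_j ((map_mx polyC M) i j * N j 0).[t] = \sum_j M i j * (N j 0).[t].
    by apply: eq_bigr => j _; rewrite mxE !hornerE.
  by rewrite /= addrAC subrr add0r.
have noroot t : s <= t -> ~~ root chi t.
  rewrite -eigenvalue_root_char => st; apply/negP => /spectral_radius_ge.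
  by rewrite leNgt (lt_le_trans s_gt) // (le_trans st) // ler_norm.
have chi_gt0 t : s <= t -> 0 < chi.[t].
  move=> st; rewrite -sgr_gt0 (@sgp_pinftyP _ s) ?in_itv/= ?st //.
    by rewrite /sgp_pinfty (monicP _) ?char_poly_monic // sgr1.
  by move=> x; rewrite in_itv /= andbT; exact: noroot.
(* Beyond [B], which exceeds every row sum, the minimum of the entries cannot be
   nonpositive. *)
pose B := Num.max s (1 + \sum_i \sum_j M i j).
have sB : s <= B by rewrite le_max lexx.
have N_large t : B <= t -> forall i, 0 < (N i 0).[t].
  move=> Bt i; rewrite ltNge; apply/negP => Ni.
  case: (@arg_minP _ _ _ i xpredT (fun j => (N j 0).[t]) isT) => k _ kmin.
  set v := (N k 0).[t] in kmin; have v0 : v <= 0 := le_trans (kmin i isT) Ni.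
  have rB : 1 + \sum_j M k j <= t.
    apply: le_trans Bt; rewrite le_max; apply/orP; right.
    rewrite lerD2l [leRHS](bigD1 k) //= lerDl sumr_ge0 // => k' _.
    by apply: sumr_ge0.
  have /ltW st := lt_le_trans (lt_le_trans s_gt sB) Bt.
  have := chi_gt0 t (le_trans sB Bt); have := chiE k t; rewrite -/v.
  have : (\sum_j M k j) * v <= \sum_j M k j * (N j 0).[t].
    by rewrite mulr_suml ler_sum // => j _; rewrite ler_wpM2l ?kmin.
  nra.
pose Q := \prod_i N i 0.
have rootQ i t : root (N i 0) t -> root Q t.
  by rewrite /root horner_prod => /eqP Nt; rewrite (bigD1 i) //= Nt mul0r.
have Q0 : Q != 0.
  apply/eqP => Q0; have : Q.[B] = 0 by rewrite Q0 horner0.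
  by apply/eqP; rewrite horner_prod; apply/prodf_neq0 => i _; rewrite gt_eqF ?N_large.
have ivt i t : (N i 0).[t] <= 0 -> exists2 u, t <= u & root (N i 0) u.
  move=> Nt; have tB : t <= B.
    by rewrite leNgt; apply/negP => /ltW/N_large/(_ i); rewrite ltNge Nt.
  have [|u /andP[tu _] Nu] := @poly_ivt R (N i 0) t B tB; last by exists u.
  by rewrite Nt ltW ?N_large.
have N_gt0 i : 0 < (N i 0).[s].
  rewrite ltNge; apply/negP => /ivt[u su Nu].
  have [|t0 t0r t0max] := @seq_max_exists _ [seq x <- rootsR Q | s <= x] u.
    by rewrite mem_filter su -(roots_on_rootsR Q0) in_itv /= (rootQ i).
  move: t0r; rewrite mem_filter => /andP[st0].
  rewrite -(roots_on_rootsR Q0) in_itv /= => /rootP.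
  rewrite /Q horner_prod => /eqP/prodf_eq0[k _ /eqP Nk].
  have Nge0 j : 0 <= (N j 0).[t0].
    rewrite leNgt; apply/negP => Nj.
    have [v t0v Nv] := ivt j t0 (ltW Nj).
    have /t0max vt0 : v \in [seq x <- rootsR Q | s <= x].
      by rewrite mem_filter (le_trans st0) // -(roots_on_rootsR Q0) in_itv /= (rootQ j).
    by move: Nj; rewrite (@le_anti _ _ t0 v) ?t0v ?vt0 // (rootP Nv) ltxx.
  have := chiE k t0; rewrite Nk mulr0 => /eqP; rewrite lt_eqF // ltr_wpDl ?chi_gt0 //.
  by apply: sumr_ge0 => j _; rewrite mulr_ge0.
exists (fun i => (N i 0).[s]); split=> // i.
by rewrite chiE lerDl ltW ?chi_gt0.
Qed.
End PositiveWeights.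

(** * Linear algebra indexed by finite types *)

Lemma injective_operator_surjective (F : fieldType) (T : finType)
    (A : (T -> F) -> T -> F) :
  (forall a f g s, A (fun t => a * f t + g t) s = a * A f s + A g s) ->
  (forall f, (forall s, A f s = 0) -> forall s, f s = 0) ->
  forall g, exists f, forall s, A f s = g s.
Proof.
move=> Alin Ainj g.
pose fun_of (u : 'rV[F]_#|T|) t := u 0 (enum_rank t).
pose B (u : 'rV[F]_#|T|) : 'rV[F]_#|T| := \row_i A (fun_of u) (enum_val i).
have Blin : linear B.
  move=> a u v; apply/rowP=> i; rewrite !mxE -Alin; congr A.
  by apply: funext => t; rewrite /fun_of !mxE.
pose BL : {linear 'rV[F]_#|T| -> 'rV[F]_#|T|} :=
  HB.pack B (GRing.isLinear.Build _ _ _ _ B Blin).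
have BE u t : (u *m lin1_mx BL) 0 (enum_rank t) = A (fun_of u) t.
  by rewrite mul_rV_lin1 /= mxE enum_rankK.
have Bunit : lin1_mx BL \in unitmx.
  rewrite -row_free_unit; apply: inj_row_free => v v0; apply/rowP => i.
  rewrite mxE -(enum_valK i); apply: (Ainj (fun_of v)) => s.
  by rewrite -BE v0 mxE.
pose v := \row_i g (enum_val i) *m invmx (lin1_mx BL).
by exists (fun_of v) => s; rewrite -BE mulmxKV // mxE enum_rankK.
Qed.

(** The eigenvector given here is a column vector (the transpose has the same
    characteristic polynomial), extended by [0] outside [D]. *)
Lemma eigenvalue_mx_on (F : fieldType) (T : finType) (D : {set T})
    (f : T -> T -> F) (a : F) :
  eigenvalue (mx_on D f) a ->
  exists v : T -> F, [/\ forall p, p \notin D -> v p = 0,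
    exists2 p, p \in D & v p != 0 &
    forall p, p \in D -> \sum_(r in D) f p r * v r = a * v p].
Proof.
rewrite eigenvalue_root_char /root => /eqP charD.
have : \det ((a%:M - mx_on D f)^T) = 0.
  rewrite det_tr -charD /char_poly -horner_evalE -det_map_mx.
  congr (\det _); apply/matrixP => i j.
  by rewrite !mxE /= /horner_eval !hornerE; case: eqP; rewrite ?hornerE.
move=> /eqP/det0P[u /rV0Pn[i0 ui0] uD].
pose v p := if p \in D then u 0 (enum_rank_in (enum_valP i0) p) else 0.
have vE i : v (enum_val i) = u 0 i by rewrite /v enum_valP enum_valK_in.
exists v; split=> [p pD||p pD].
- by rewrite /v (negPf pD).
- by exists (enum_val i0); rewrite ?enum_valP ?vE.
set i := enum_rank_in (enum_valP i0) p.
have pE : p = enum_val i by rewrite enum_rankK_in.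
rewrite pE big_enum_val vE.
have : (u *m (a%:M - mx_on D f)^T) 0 i = 0 by rewrite uD mxE.
rewrite linearB /= mulmxBr tr_scalar_mx mul_mx_scalar !mxE => /eqP.
rewrite subr_eq0 => /eqP ->; apply: eq_bigr => j _.
by rewrite !mxE vE mulrC.
Qed.

Lemma largest_eigenvalue_le (R : realType) n (M : 'M[R]_n) (b : R) :
  0 <= b -> (forall r, eigenvalue M r -> r <= b) -> largest_eigenvalue M <= b.
Proof.
move=> b0 Mb; rewrite /largest_eigenvalue; set E := (X in sup X).
have [->|E0] := eqVneq E classical_sets.set0; first by rewrite sup0.
by apply: ge_sup; [exact/classical_sets.set0P|move=> r; exact: Mb].
Qed.

(** * Local conditional distributions *)

(** The configuration [s] with the spin at [y] replaced by [a]. *)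
Definition update {q : nat} {V : finType} (s : config q V) (y : V) (a : 'I_q) :
    config q V :=
  [ffun z => if z == y then a else s z].

Lemma update_same q (V : finType) (s : config q V) y a : update s y a y = a.
Proof. by rewrite ffunE eqxx. Qed.

Lemma update_other q (V : finType) (s : config q V) y a z :
  z != y -> update s y a z = s z.
Proof. by rewrite ffunE => /negPf ->. Qed.

Lemma update_id q (V : finType) (s : config q V) y : update s y (s y) = s.
Proof. by apply/ffunP => z; rewrite ffunE; case: eqP => [->|]. Qed.

Lemma update_update q (V : finType) (s : config q V) y a b :
  update (update s y a) y b = update s y b.
Proof. by apply/ffunP => z; rewrite !ffunE; case: eqP. Qed.

Section LocalConditional.
Variables (R : realType) (q : nat) (V dV : finType).
Variable S : spin_system R q V dV.
Implicit Types (s t : config q V) (x y : V) (a b : 'I_q).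

Lemma local_weight_ge0 y s a : 0 <= local_weight S y s a.
Proof.
rewrite /local_weight !mulr_ge0 ?ext_field_ge0 //.
  by apply: prodr_ge0 => z yz; apply: inter_ge0.
by apply: prodr_ge0 => z yz; apply: binter_ge0.
Qed.

Lemma weight_ge0 s : 0 <= weight S s.
Proof.
rewrite /weight !mulr_ge0 //.
- by apply: prodr_ge0 => e /andP[yz _]; apply: inter_ge0.
- by apply: prodr_ge0 => e yz; apply: binter_ge0.
- by apply: prodr_ge0 => x _; apply: ext_field_ge0.
Qed.

Lemma eq_local_weight y s t a :
  (forall z, z != y -> s z = t z) -> local_weight S y s a = local_weight S y t a.
Proof.
move=> st; rewrite /local_weight; congr (_ * _ * _).
apply: eq_bigr => z yz; rewrite st //.
by apply: contraTneq yz => ->; rewrite edge_irr.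
Qed.

Lemma eq_local_cond y s t :
  (forall z, z != y -> s z = t z) -> local_cond S y s = local_cond S y t.
Proof.
move=> st; apply: funext => a; rewrite /local_cond (eq_local_weight _ st).
by congr (_ / _); apply: eq_bigr => b _; exact: eq_local_weight.
Qed.

Lemma eq_local_defined y s t :
  (forall z, z != y -> s z = t z) -> local_defined S y s = local_defined S y t.
Proof.
move=> st; rewrite /local_defined.
by congr (_ < _); apply: eq_bigr => b _; exact: eq_local_weight.
Qed.

Lemma local_cond_update y s a : local_cond S y (update s y a) = local_cond S y s.
Proof. by apply: eq_local_cond => z zy; rewrite update_other. Qed.

Lemma local_cond_ge0 y s a : 0 <= local_cond S y s a.
Proof.
rewrite /local_cond divr_ge0 ?local_weight_ge0 //.
by apply: sumr_ge0 => b _; apply: local_weight_ge0.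
Qed.

Lemma local_cond_sum1 y s :
  local_defined S y s -> \sum_a local_cond S y s a = 1.
Proof. by move=> ds; rewrite -mulr_suml divff // gt_eqF. Qed.

Lemma local_cond_gt0 y s a :
  0 < local_cond S y s a -> 0 < local_weight S y s a.
Proof.
rewrite !lt0r local_weight_ge0 andbT => /andP[+ _].
by apply: contra => /eqP h; rewrite /local_cond h mul0r.
Qed.

Lemma local_weight_defined y s a : 0 < local_weight S y s a -> local_defined S y s.
Proof.
move=> h; apply: (lt_le_trans h); rewrite (bigD1 a) //= lerDl sumr_ge0 // => b _.
exact: local_weight_ge0.
Qed.

(** The weight, as a function of the spin at [y] alone, is proportional to the
    local weight at [y]. *)
Lemma weight_update y s : exists c, forall a,
  weight S (update s y a) = local_weight S y s a * c.
Proof.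
have updE x a : x != y -> update s y a x = s x by exact: update_other.
pose lt (x z : V) := (enum_rank x < enum_rank z)%N.
(* The factors that do not involve [y]; those that do are
   [local_weight S y s a], where the edges at [y] are collected whatever their
   orientation. *)
exists ((\prod_(x | x != y) \prod_(z | (edge S x z && lt x z) && (z != y))
            inter S x z (s x) (s z)) *
  (\prod_(x | x != y) \prod_(z | bedge S x z) binter S x z (s x) (bcond S z)) *
  \prod_(x | x != y) ext_field S x 0 (s x)) => a.
set s' := update s y a.
rewrite /weight /local_weight.
have -> : \prod_x ext_field S x 0 (s' x) =
    ext_field S y 0 a * \prod_(x | x != y) ext_field S x 0 (s x).
  rewrite (bigD1 y) //= update_same; congr (_ * _).
  by apply: eq_bigr => x xy; rewrite updE.
have -> : \prod_(e | bedge S e.1 e.2) binter S e.1 e.2 (s' e.1) (bcond S e.2) =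
    (\prod_(z | bedge S y z) binter S y z a (bcond S z)) *
    \prod_(x | x != y) \prod_(z | bedge S x z) binter S x z (s x) (bcond S z).
  rewrite -(pair_big_dep xpredT (fun x z => bedge S x z)
    (fun x z => binter S x z (s' x) (bcond S z))) /=.
  rewrite (bigD1 y) //= update_same; congr (_ * _).
  by apply: eq_bigr => x xy; rewrite updE.
have -> : \prod_(e | edge S e.1 e.2 && lt e.1 e.2)
      inter S e.1 e.2 (s' e.1) (s' e.2) =
    (\prod_(z | edge S y z) inter S y z a (s z)) *
    \prod_(x | x != y) \prod_(z | (edge S x z && lt x z) && (z != y))
      inter S x z (s x) (s z).
  rewrite -(pair_big_dep xpredT (fun x z => edge S x z && lt x z)
    (fun x z => inter S x z (s' x) (s' z))) /=.
  rewrite (bigD1 y) //= update_same [in RHS](bigID (lt y)) /= -mulrA.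
  congr (_ * _).
    apply: eq_bigr => z /andP[yz _]; rewrite updE //.
    by apply: contraTneq yz => ->; rewrite edge_irr.
  have inner x : x != y -> \prod_(z | edge S x z && lt x z)
        inter S x z (s' x) (s' z) =
      (if edge S y x && lt x y then inter S y x a (s x) else 1) *
      \prod_(z | (edge S x z && lt x z) && (z != y)) inter S x z (s x) (s z).
    move=> xy; rewrite (bigID (pred1 y)) /=; congr (_ * _); last first.
      by apply: eq_bigr => z /andP[_ zy]; rewrite !updE.
    have -> : edge S y x = edge S x y by rewrite edge_sym.
    case: ifPn => [/andP[xey xly]|nxy].
      rewrite (big_pred1 y) => [|z]; last first.
        by rewrite /= andbC; case: eqP => // ->; rewrite xey xly.
      rewrite update_same updE // -(inter_sym xey) mxE.
      by rewrite interC.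
    apply: big_pred0 => z; rewrite andbC; case: eqP => //= ->.
    exact: negbTE.
  rewrite (eq_bigr _ inner) big_split /=; congr (_ * _).
  rewrite -big_mkcondr /=; apply: eq_bigl => x.
  rewrite /lt; case: (eqVneq x y) => [->|xy]; first by rewrite edge_irr.
  rewrite /= -leqNgt [in RHS]leq_eqVlt.
  suff /negPf-> : nat_of_ord (enum_rank x) != enum_rank y by [].
  by apply: contraNneq xy => /val_inj/enum_rank_inj ->.
ring.
Qed.

End LocalConditional.

(** * Heat-bath updates and conditioning *)

Section HeatBath.
Variables (R : realType) (q : nat) (V dV : finType).
Variable S : spin_system R q V dV.
Implicit Types (s t : config q V) (x y : V) (a b : 'I_q).
Implicit Types (nu : config q V -> R) (h : config q V -> R).

(** The conditional expectation of [h] when the spin at [y] is resampled from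
    its local conditional distribution. *)
Definition heat_bath y h s : R :=
  \sum_a local_cond S y s a * h (update s y a).

(** Detailed balance of [nu] for the heat-bath update at [y]: the move from [s]
    to [update s y a] and the reverse move carry the same mass. *)
Definition reversible_at nu y : Prop := forall s a,
  nu s * local_cond S y s a =
  nu (update s y a) * local_cond S y (update s y a) (s y).

Lemma weight_gt0_local_weight y s :
  0 < weight S s -> 0 < local_weight S y s (s y).
Proof.
have [c /(_ (s y))] := weight_update S y s; rewrite update_id => ->.
rewrite !lt0r local_weight_ge0 andbT => /andP[+ _].
by apply: contra => /eqP ->; rewrite mul0r.
Qed.

Lemma weight_gt0_defined y s : 0 < weight S s -> local_defined S y s.
Proof. by move=> /(weight_gt0_local_weight y)/local_weight_defined. Qed.

Lemma weight_reversible y : reversible_at (weight S) y.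
Proof.
move=> s a; rewrite local_cond_update.
have [c wE] := weight_update S y s.
by rewrite -{1}[s](update_id s y) !wE /local_cond; ring.
Qed.

Lemma scale_reversible nu y c :
  reversible_at nu y -> reversible_at (fun s => nu s * c) y.
Proof. by move=> rev s a; rewrite mulrAC rev mulrAC. Qed.

Lemma cond_reversible nu y (A : pred (config q V)) :
  (forall s a, A (update s y a) = A s) ->
  reversible_at nu y -> reversible_at (cond nu A) y.
Proof.
move=> Ay rev; apply: scale_reversible => s a; rewrite Ay.
by case: (A s); rewrite ?mul0r.
Qed.

Lemma heat_bath_lin y c h h' s :
  heat_bath y (fun t => c * h t + h' t) s = c * heat_bath y h s + heat_bath y h' s.
Proof.
rewrite /heat_bath mulr_sumr -big_split; apply: eq_bigr => a _ /=.
by rewrite mulrDr mulrCA.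
Qed.

(** Stationarity, from detailed balance: the double sum over a configuration
    and a new spin at [y] is invariant under exchanging the old and the new
    spin. *)
Lemma expect_heat_bath nu y h :
  reversible_at nu y -> (forall s, nu s != 0 -> local_defined S y s) ->
  \sum_s nu s * heat_bath y h s = \sum_s nu s * h s.
Proof.
move=> rev def.
pose flip (p : config q V * 'I_q) := (update p.1 y p.2, p.1 y).
have flipK : involutive flip.
  by case=> s a; rewrite /flip /= update_update update_id update_same.
transitivity (\sum_(p : config q V * 'I_q)
    nu p.1 * local_cond S y p.1 p.2 * h p.1).
  rewrite (reindex_inj (inv_inj flipK)) /=.
  rewrite -(pair_bigA _ (fun s a => nu (update s y a) *
    local_cond S y (update s y a) (s y) * h (update s y a))) /=.
  apply: eq_bigr => s _; rewrite mulr_sumr; apply: eq_bigr => a _.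
  by rewrite mulrA rev.
rewrite -(pair_bigA _ (fun s a => nu s * local_cond S y s a * h s)) /=.
apply: eq_bigr => s _; have [->|/def ds] := eqVneq (nu s) 0.
  by rewrite mul0r big1 // => a _; rewrite !mul0r.
by rewrite -mulr_suml -mulr_sumr local_cond_sum1 // mulr1.
Qed.

End HeatBath.

Section Conditioning.
Variables (R : realType) (q : nat) (V : finType).
Implicit Types (mu : config q V -> R) (A B : pred (config q V)).

Lemma prob_ge0 mu A : (forall s, 0 <= mu s) -> 0 <= prob mu A.
Proof. by move=> mu0; apply: sumr_ge0. Qed.

Lemma cond_ge0 mu A s : (forall s, 0 <= mu s) -> 0 <= cond mu A s.
Proof. by move=> mu0; rewrite /cond divr_ge0 ?prob_ge0 //; case: ifP. Qed.

Lemma prob_gt0 mu A s :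
  (forall s, 0 <= mu s) -> A s -> 0 < mu s -> 0 < prob mu A.
Proof.
move=> mu0 As ms; apply: (lt_le_trans ms).
by rewrite /prob (bigD1 s) //= lerDl sumr_ge0.
Qed.

Lemma cond_gt0 mu A s :
  (forall s, 0 <= mu s) -> (0 < cond mu A s) = A s && (0 < mu s).
Proof.
move=> mu0; rewrite /cond; case: (boolP (A s)) => As /=; last by rewrite mul0r ltxx.
have [ms|] := ltP 0 (mu s); first by rewrite divr_gt0 ?(prob_gt0 mu0 As).
by move=> ms; rewrite (@le_anti _ _ (mu s) 0) ?mu0 ?ms // mul0r ltxx.
Qed.

Lemma cond_sum1 mu A : 0 < prob mu A -> \sum_s cond mu A s = 1.
Proof.
move=> p0; rewrite -mulr_suml -big_mkcond /= divff //.
by rewrite gt_eqF.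
Qed.

Lemma prob_has_spin_sum mu (f : 'I_q -> R) y :
  \sum_b prob mu (has_spin y b) * f b = \sum_s mu s * f (s y).
Proof.
rewrite [RHS](partition_big (fun s : config q V => s y) xpredT) //=.
apply: eq_bigr => b _; rewrite /prob mulr_suml.
by apply: eq_bigr => s /eqP ->.
Qed.

End Conditioning.

(** * Total variation distance and interpolation *)

Section TotalVariation.
Variables (R : realType) (q : nat).
Implicit Types p : 'I_q -> R.

Lemma dTVxx p : dTV p p = 0.
Proof. by rewrite /dTV big1 ?mulr0 // => a _; rewrite subrr normr0. Qed.

Lemma dTVC p1 p2 : dTV p1 p2 = dTV p2 p1.
Proof. by congr (_ * _); apply: eq_bigr => a _; rewrite distrC. Qed.

Lemma dTV_triangle p1 p2 p3 : dTV p1 p3 <= dTV p1 p2 + dTV p2 p3.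
Proof.
rewrite /dTV -mulrDr ler_wpM2l ?invr_ge0 // -big_split ler_sum // => a _.
exact: ler_distD.
Qed.

Lemma dTV_le1 p1 p2 : (forall a, 0 <= p1 a) -> (forall a, 0 <= p2 a) ->
  \sum_a p1 a = 1 -> \sum_a p2 a = 1 -> dTV p1 p2 <= 1.
Proof.
move=> p1_ge0 p2_ge0 s1 s2.
have : \sum_a `|p1 a - p2 a| <= \sum_a (p1 a + p2 a).
  apply: ler_sum => a _; rewrite -{2}(ger0_norm (p1_ge0 a)).
  by rewrite -{2}(ger0_norm (p2_ge0 a)) ler_normB.
by rewrite big_split /= s1 s2 /dTV; lra.
Qed.

Lemma dTV_lt1_common p1 p2 : (forall a, 0 <= p1 a) -> (forall a, 0 <= p2 a) ->
  \sum_a p1 a = 1 -> \sum_a p2 a = 1 -> dTV p1 p2 < 1 ->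
  exists a, 0 < p1 a /\ 0 < p2 a.
Proof.
move=> p1_ge0 p2_ge0 s1 s2 d1.
have [/existsP[a /andP[]]|/existsPn no] :=
  boolP [exists a, (0 < p1 a) && (0 < p2 a)]; first by exists a.
suff : dTV p1 p2 = 1 by move=> d; rewrite d ltxx in d1.
have -> : dTV p1 p2 = 2^-1 * \sum_a (p1 a + p2 a).
  congr (_ * _); apply: eq_bigr => a _; have := no a.
  have := p1_ge0 a; have := p2_ge0 a; rewrite !le0r.
  case/orP => [/eqP->|->].
    by rewrite subr0 addr0 => /orP[/eqP->|/gtr0_norm//]; rewrite normr0.
  rewrite andbT => /orP[/eqP->|->//] _; rewrite sub0r normrN add0r.
  exact: ger0_norm.
by rewrite big_split /= s1 s2; lra.
Qed.

End TotalVariation.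

(** The configuration equal to [s] on [X] and to [u] elsewhere. *)
Definition hybrid {q : nat} {V : finType} (X : {set V}) (s u : config q V) :
    config q V :=
  [ffun z => if z \in X then s z else u z].

Section Interpolation.
Variables (R : realType) (q : nat) (V dV : finType).
Variable S : spin_system R q V dV.
Implicit Types (s t u v : config q V) (x y : V) (a b : 'I_q) (X Y D : {set V}).

Lemma dobrushin_ge0 x y : 0 <= dobrushin S x y.
Proof.
rewrite /dobrushin; case: ifP => // _.
elim/big_ind: _ => // [a b a0 b0|p _]; first by rewrite le_max a0.
by rewrite /dTV mulr_ge0 ?invr_ge0 // sumr_ge0.
Qed.

Lemma dTV_le_dobrushin x y s t : x != y -> differ_only_at x y s t ->
  local_defined S y s -> local_defined S y t ->
  dTV (local_cond S y s) (local_cond S y t) <= dobrushin S x y.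
Proof.
move=> xy st ds dt; rewrite /dobrushin (negPf xy).
pose P (p : config q V * config q V) := [&& differ_only_at x y p.1 p.2,
  local_defined S y p.1 & local_defined S y p.2].
pose F (p : config q V * config q V) :=
  dTV (local_cond S y p.1) (local_cond S y p.2).
have Pst : P (s, t) by rewrite /P /= st ds.
exact: (le_bigmax_cond 0 F Pst).
Qed.

(** The spin [a] is allowed at [y] next to any neighbourhood mixed from two
    neighbourhoods that allow it. *)
Lemma local_weight_mix y s t u a :
  (forall z, z != y -> u z = s z \/ u z = t z) ->
  0 < local_weight S y s a -> 0 < local_weight S y t a ->
  0 < local_weight S y u a.
Proof.
move=> mix; rewrite !lt0r !local_weight_ge0 !andbT /local_weight.
rewrite !mulf_eq0 !negb_or => /andP[/andP[-> /prodf_neq0 hs] ->].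
move=> /andP[/andP[_ /prodf_neq0 ht] _]; rewrite andbT.
apply/prodf_neq0 => z yz; have zy : z != y.
  by apply: contraTneq yz => ->; rewrite edge_irr.
by case: (mix z zy) => ->; [exact: hs|exact: ht].
Qed.

(** Interpolation between [u] and [hybrid X s u], one site of [X] at a time. *)
Lemma dTV_hybrid y s u X : y \notin X ->
  (forall Y, Y \subset X -> local_defined S y (hybrid Y s u)) ->
  dTV (local_cond S y u) (local_cond S y (hybrid X s u)) <=
    \sum_(x in X) dobrushin S x y.
Proof.
have [n] := ubnP #|X|; elim: n X => // n IH X Xn yX def.
have [->|[x xX]] := set_0Vmem X.
  rewrite big_set0 (_ : hybrid set0 s u = u) ?dTVxx //.
  by apply/ffunP => z; rewrite ffunE inE.
have xy : x != y by apply: contraNneq yX => <-.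
rewrite (big_setD1 x xX) /= addrC.
apply: le_trans (dTV_triangle _ (local_cond S y (hybrid (X :\ x) s u)) _) _.
have DX := subsetDl X [set x].
apply: lerD.
  apply: IH; first by move: Xn; rewrite (cardsD1 x) xX.
    by rewrite inE (negPf yX) andbF.
  by move=> Y YX; apply: def; apply: subset_trans DX.
apply: dTV_le_dobrushin; rewrite ?def //.
apply/forallP => z; apply/implyP => /andP[zx _].
by rewrite !ffunE !inE zx.
Qed.

(** One step of a path from [s] that only moves sites of [D] and [y], when the
    total influence of [D] on [y] is below [1]: if all hybrids of [s] and the
    current point [u] are locally defined at [y], so are those of [s] and the
    next point [v].  The only nontrivial case is that of a moved site of [D]
    outside [X].  Then the laws of the spin at [y] given [v] and given
    [hybrid X s u] are at distance less than [1], so some spin is charged by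
    both, and this spin is allowed by [hybrid X s v]. *)
Lemma hybrid_defined_step y s u v D :
  y \notin D -> \sum_(x in D) dobrushin S x y < 1 ->
  local_defined S y u -> local_defined S y v ->
  (forall z, z \notin y |: D -> u z = v z) -> hamming u v = 1%N ->
  (forall X, X \subset D -> local_defined S y (hybrid X s u)) ->
  forall X, X \subset D -> local_defined S y (hybrid X s v).
Proof.
move=> yD sumD du dv uvD /eqP/cards1P[i uvi] defu X XD.
have uvE z : z != i -> u z = v z.
  move=> zi; apply/eqP; move/setP/(_ z): uvi.
  by rewrite !inE (negPf zi) => /negbT; rewrite negbK.
have uvne : u i != v i by move/setP/(_ i): uvi; rewrite !inE eqxx.
have [iy|iy] := eqVneq i y.
  rewrite (@eq_local_defined _ _ _ _ S y _ (hybrid X s u)) ?defu // => z.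
  by rewrite -iy => zi; rewrite !ffunE uvE.
have [iX|iX] := boolP (i \in X).
  rewrite (_ : hybrid X s v = hybrid X s u) ?defu //; apply/ffunP => z.
  by rewrite !ffunE; case: ifPn => // zX; rewrite uvE //; apply: contraNneq zX => ->.
have iD : i \in D.
  by apply: contraNT uvne => iD; rewrite uvD // !inE (negPf iy).
have uv1 : dTV (local_cond S y v) (local_cond S y u) <= dobrushin S i y.
  apply: dTV_le_dobrushin => //; apply/forallP => z; apply/implyP => /andP[zi _].
  by rewrite uvE.
have uX : dTV (local_cond S y u) (local_cond S y (hybrid X s u)) <=
    \sum_(x in X) dobrushin S x y.
  apply: dTV_hybrid; first by apply: contra yD; apply/subsetP.
  by move=> Y YX; apply: defu; apply: subset_trans XD.
have iXD : dobrushin S i y + \sum_(x in X) dobrushin S x y <=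
    \sum_(x in D) dobrushin S x y.
  rewrite (big_setD1 i iD) lerD2l /=.
  rewrite [leRHS](big_setID X) /= (setIidPr _); last first.
    apply/subsetP => x xX; rewrite !inE (subsetP XD) // andbT.
    by apply: contraNneq iX => <-.
  by rewrite lerDl sumr_ge0 // => x _; exact: dobrushin_ge0.
have [|||||a [/local_cond_gt0 va /local_cond_gt0 ha]] :=
  @dTV_lt1_common R q (local_cond S y v) (local_cond S y (hybrid X s u)).
- exact: local_cond_ge0.
- exact: local_cond_ge0.
- exact: local_cond_sum1.
- by apply: local_cond_sum1; exact: defu.
- apply: le_lt_trans sumD; apply: le_trans iXD.
  by apply: le_trans (dTV_triangle _ _ _) _; exact: lerD uv1 uX.
apply: (@local_weight_defined _ _ _ _ S y _ a); apply: local_weight_mix va ha => z _.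
by rewrite !ffunE; case: ifP; [right|left].
Qed.

Lemma gibbs_ge0 s : 0 <= gibbs S s.
Proof.
rewrite /gibbs divr_ge0 ?weight_ge0 // sumr_ge0 // => t _.
exact: weight_ge0.
Qed.

Lemma gibbs_gt0 s : (0 < gibbs S s) = (0 < weight S s).
Proof.
have [ws|] := ltP 0 (weight S s).
  rewrite /gibbs divr_gt0 // (bigD1 s) ?inE //= ltr_wpDr //.
  by apply: sumr_ge0 => t _; exact: weight_ge0.
move=> ws; rewrite /gibbs (@le_anti _ _ (weight S s) 0) ?weight_ge0 ?ws //.
by rewrite mul0r ltxx.
Qed.

(** The sum runs over the sites other than [y] where the two feasible
    configurations differ; the intermediate configurations of a direct
    interpolation need not be feasible. *)
Lemma dTV_le_sum_dobrushin y s t :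
  totally_connected (gibbs S) -> 0 < weight S s -> 0 < weight S t ->
  dTV (local_cond S y s) (local_cond S y t) <=
    \sum_(x | (x != y) && (s x != t x)) dobrushin S x y.
Proof.
move=> tc ws wt; pose D := [set x | (x != y) && (s x != t x)].
rewrite (eq_bigl [in D]) => [|x]; last by rewrite !inE.
have [D1|D1] := leP 1 (\sum_(x in D) dobrushin S x y).
  apply: le_trans D1; apply: dTV_le1; try exact: local_cond_ge0;
    exact/local_cond_sum1/weight_gt0_defined.
have yD : y \notin D by rewrite !inE eqxx.
(* Under this pinning only the spins at [y] and on [D] are free, hence so they
   are along any path in the support. *)
pose U := ~: (y |: D).
have suppE u : (u \in supp (pinned (gibbs S) U s)) =
    agree_on U s u && (0 < weight S u).
  by rewrite inE cond_gt0 ?gibbs_gt0 //; exact: gibbs_ge0.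
have ss : agree_on U s s by apply/forall_inP.
have st : agree_on U s t.
  apply/forall_inP => x; rewrite !inE negb_or negb_and negbK => /andP[/negPf -> /=].
  by rewrite negbK eq_sym.
have pin : pinning (gibbs S) U s.
  by apply/existsP; exists s; rewrite inE gibbs_gt0 ws.
have sU : s \in supp (pinned (gibbs S) U s) by rewrite suppE ss.
have tU : t \in supp (pinned (gibbs S) U s) by rewrite suppE st.
have /connectP[p pth tE] := tc U s pin s t sU tU.
suff def X : X \subset D -> local_defined S y (hybrid X s t).
  have := dTV_hybrid yD (s := s) (u := t) def; rewrite dTVC.
  rewrite (@eq_local_cond _ _ _ _ S y (hybrid D s t) s) // => z zy.
  by rewrite ffunE !inE zy /=; case: eqP => // ->.
have defs Y : Y \subset D -> local_defined S y (hybrid Y s s).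
  move=> _; rewrite (_ : hybrid Y s s = s) ?weight_gt0_defined //.
  by apply/ffunP => z; rewrite ffunE if_same.
pose move_rel u v := [&& u \in supp (pinned (gibbs S) U s),
  v \in supp (pinned (gibbs S) U s) & hamming u v == 1%N].
suff walk u : path move_rel u p ->
    (forall Y, Y \subset D -> local_defined S y (hybrid Y s u)) ->
    forall Y, Y \subset D -> local_defined S y (hybrid Y s (last u p)).
  by rewrite tE; exact: walk pth defs X.
elim: p u {pth tE} => //= v p IH u /andP[].
case/and3P; rewrite !suppE => /andP[su wu] /andP[sv wv] /eqP uv pth defu.
apply: IH pth _; apply: hybrid_defined_step uv defu => //;
  try exact: weight_gt0_defined.
move=> z zD; have zU : z \in U by rewrite inE.
by rewrite (eqP (forall_inP su z zU)) (eqP (forall_inP sv z zU)).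
Qed.

End Interpolation.

(** * Contraction and the Poisson equation *)

(** A form of Kantorovich duality for the discrete metric that needs [h1] and
    [h2] to be compared only on the supports of [p1] and [p2]; [phi] is a
    function of oscillation at most [c] squeezed between the two. *)
Lemma expect_diff_le_dTV (R : realType) (q : nat) (p1 p2 h1 h2 : 'I_q -> R)
    (K c : R) :
  (forall a, 0 <= p1 a) -> (forall a, 0 <= p2 a) ->
  \sum_a p1 a = 1 -> \sum_a p2 a = 1 -> 0 <= c ->
  (forall a b, 0 < p1 a -> 0 < p2 b ->
     h1 a - h2 b <= K + (if a == b then 0 else c)) ->
  \sum_a p1 a * h1 a - \sum_a p2 a * h2 a <= K + c * dTV p1 p2.
Proof.
move=> p1_ge0 p2_ge0 s1 s2 c0 h12.
have [a0 pa0] : exists a, 0 < p1 a.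
  apply: contrapT => no.
  have : \sum_a p1 a = 0.
    apply: big1 => a _; apply/le_anti; rewrite p1_ge0 andbT leNgt.
    by apply/negP => pa; apply: no; exists a.
  by rewrite s1 => /eqP; rewrite oner_eq0.
case: (@arg_maxP _ _ _ a0 (fun a => 0 < p1 a) h1 pa0) => a1 pa1 max1.
(* [phi] is the larger of the cut-off [h1 a1 - c] and [h1], the latter only where
   [p1] is positive. *)
pose phi b := if 0 < p1 b then Num.max (h1 b) (h1 a1 - c) else h1 a1 - c.
have phi_le b : phi b <= h1 a1.
  rewrite /phi; case: ifP => [pb|_]; last by rewrite gerBl.
  by rewrite ge_max gerBl c0 andbT; exact: max1.
have phi_ge b : h1 a1 - c <= phi b.
  by rewrite /phi; case: ifP => // _; rewrite le_max lexx orbT.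
have phi1 : \sum_a p1 a * h1 a <= \sum_a p1 a * phi a.
  apply: ler_sum => a _; have := p1_ge0 a; rewrite le0r => /orP[/eqP->|pa].
    by rewrite !mul0r.
  by rewrite ler_pM2l // /phi pa le_max lexx.
have phi2 : \sum_a p2 a * phi a - K <= \sum_a p2 a * h2 a.
  rewrite -[X in _ - X]mul1r -{1}s2 mulr_suml -sumrB; apply: ler_sum => b _.
  rewrite -mulrBr; have := p2_ge0 b; rewrite le0r => /orP[/eqP->|pb].
    by rewrite !mul0r.
  rewrite ler_pM2l //.
  have h1b : h1 a1 - c - K <= h2 b.
    by have := h12 a1 b pa1 pb; case: ifP => _; lra.
  rewrite /phi; case: ifP => // p1b; rewrite lerBlDr ge_max; apply/andP; split.
    by have := h12 b b p1b pb; rewrite eqxx; lra.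
  lra.
have phi12 : \sum_a p1 a * phi a - \sum_a p2 a * phi a <= c * dTV p1 p2.
  have -> : \sum_a p1 a * phi a - \sum_a p2 a * phi a =
      \sum_a (p1 a - p2 a) * (phi a - (h1 a1 - c / 2)).
    transitivity (\sum_a (p1 a * phi a - p2 a * phi a
        - (p1 a - p2 a) * (h1 a1 - c / 2))).
      by rewrite !sumrB -mulr_suml sumrB s1 s2 subrr mul0r subr0.
    by apply: eq_bigr => a _; ring.
  rewrite /dTV mulrA mulr_sumr; apply: ler_sum => a _.
  apply: le_trans (ler_norm _) _; rewrite normrM mulrC.
  apply: ler_wpM2r => //; rewrite ler_norml.
  by have := phi_le a; have := phi_ge a; lra.
lra.
Qed.

Section Contraction.
Variables (R : realType) (q : nat) (V dV : finType).
Variable S : spin_system R q V dV.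
Hypothesis tc : totally_connected (gibbs S).
Variables (w : V -> R) (kappa : R).
Hypothesis w_gt0 : forall x, 0 < w x.
Hypothesis kappa_lt1 : kappa < 1.
Hypothesis w_kappa : forall x, \sum_y dobrushin S x y * w y <= kappa * w x.

Implicit Types (s t : config q V) (x y : V) (a b : 'I_q).
Implicit Types (g h : config q V -> R).

(** The Hamming distance weighted by [w]. *)
Definition wdist s t : R := \sum_(x | s x != t x) w x.

Lemma wdist_ge0 s t : 0 <= wdist s t.
Proof. by apply: sumr_ge0 => x _; exact: ltW. Qed.

Lemma wdist_gt0 s t : s != t -> 0 < wdist s t.
Proof.
move=> st; have [x xst] : exists x, s x != t x.
  apply: contrapT => no; case/eqP: st; apply/ffunP => x.
  by apply/eqP/negPn/negP => xst; apply: no; exists x.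
rewrite /wdist (bigD1 x) //= ltr_wpDr //.
by apply: sumr_ge0 => y _; exact: ltW.
Qed.

Lemma wdist_update s y a : wdist s (update s y a) <= w y.
Proof.
rewrite /wdist (bigID (pred1 y)) /= [X in _ + X]big1 => [|x /andP[+ xy]]; last first.
  by rewrite update_other // eqxx.
rewrite addr0 big_mkcondl (big_pred1 y) //=.
by case: ifP => // _; exact: ltW.
Qed.

Lemma wdist_update2 s t y a b : wdist (update s y a) (update t y b) =
  \sum_(x | (x != y) && (s x != t x)) w x + (if a == b then 0 else w y).
Proof.
rewrite /wdist (bigID (pred1 y)) /= addrC; congr (_ + _).
  apply: eq_bigl => x; rewrite andbC; case: eqP => //= /eqP xy.
  by rewrite !update_other.
rewrite big_mkcondl (big_pred1 y) //= !update_same.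
by case: eqP.
Qed.

Variables (U : {set V}) (nu : config q V -> R).
Hypothesis nu_ge0 : forall s, 0 <= nu s.
Hypothesis nu_sum1 : \sum_s nu s = 1.
Hypothesis nu_weight : forall s, 0 < nu s -> 0 < weight S s.
Hypothesis nu_rev : forall y, y \notin U -> reversible_at S nu y.
Hypothesis nu_pinned : forall s t, 0 < nu s -> 0 < nu t ->
  forall z, z \in U -> s z = t z.

(** Lipschitz for [wdist], on the support of [nu] only: the values of [h]
    elsewhere are arbitrary. *)
Definition lipschitz (L : R) h : Prop :=
  forall s t, 0 < nu s -> 0 < nu t -> `|h s - h t| <= L * wdist s t.

Lemma update_supp y s a : y \notin U -> 0 < nu s -> 0 < local_cond S y s a ->
  0 < nu (update s y a).
Proof.
move=> yU ns la; have : 0 < nu s * local_cond S y s a by rewrite mulr_gt0.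
rewrite nu_rev // !lt0r nu_ge0 andbT => /andP[+ _].
by apply: contra => /eqP ->; rewrite mul0r.
Qed.

Lemma heat_bath_lipschitz L h y s t : 0 <= L -> lipschitz L h ->
  y \notin U -> 0 < nu s -> 0 < nu t ->
  `|heat_bath S y h s - heat_bath S y h t| <=
    L * (\sum_(x | (x != y) && (s x != t x)) w x +
         \sum_(x | s x != t x) dobrushin S x y * w y).
Proof.
move=> L0 hL yU.
suff one s' t' : 0 < nu s' -> 0 < nu t' ->
    heat_bath S y h s' - heat_bath S y h t' <=
    L * (\sum_(x | (x != y) && (s' x != t' x)) w x +
         \sum_(x | s' x != t' x) dobrushin S x y * w y).
  move=> ns nt; rewrite ler_norml one // andbT lerNl opprB.
  apply: (le_trans (one t s nt ns)); rewrite le_eqVlt; apply/orP; left.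
  by apply/eqP; congr (_ * (_ + _)); apply: eq_bigl => x; rewrite (eq_sym (s x)).
move=> ns nt.
pose K := L * \sum_(x | (x != y) && (s' x != t' x)) w x.
have le1 : heat_bath S y h s' - heat_bath S y h t' <=
    K + L * w y * dTV (local_cond S y s') (local_cond S y t').
  apply: expect_diff_le_dTV; try exact: local_cond_ge0;
    try exact/local_cond_sum1/weight_gt0_defined/nu_weight.
    by rewrite mulr_ge0 // ltW.
  move=> a b pa pb; apply: le_trans (ler_norm _) _.
  apply: le_trans (hL _ _ _ _) _; [exact: update_supp|exact: update_supp|].
  by rewrite wdist_update2 mulrDr lerD2l; case: eqP; rewrite ?mulr0.
apply: (le_trans le1); rewrite mulrDr lerD2l -mulrA ler_wpM2l // -mulr_suml mulrC.
rewrite ler_wpM2r ?(ltW (w_gt0 y)) //.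
apply: le_trans (dTV_le_sum_dobrushin y tc (nu_weight ns) (nu_weight nt)) _.
rewrite [leRHS](bigID (pred1 y)) /= ler_wpDl //.
  by apply: sumr_ge0 => x _; exact: dobrushin_ge0.
by rewrite le_eqVlt; apply/orP; left; apply/eqP; apply: eq_bigl => x; rewrite andbC.
Qed.

(** The number of sites that are not pinned. *)
Definition free_sites : R := #|~: U|%:R.

(** A site [x] where [s] and [t] differ is counted with weight [w x] by the
    updates at all free sites but [x], and contributes at most
    [\sum_y dobrushin S x y * w y <= kappa * w x] to the discrepancies newly
    created. *)
Lemma sum_heat_bath_lipschitz L h s t : 0 <= L -> lipschitz L h ->
  0 < nu s -> 0 < nu t ->
  `|\sum_(y in ~: U) (heat_bath S y h s - heat_bath S y h t)| <=
    L * (free_sites - 1 + kappa) * wdist s t.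
Proof.
move=> L0 hL ns nt; apply: le_trans (ler_norm_sum _ _ _) _.
apply: (@le_trans _ _ (\sum_(y in ~: U) L *
    (\sum_(x | (x != y) && (s x != t x)) w x +
     \sum_(x | s x != t x) dobrushin S x y * w y))).
  by apply: ler_sum => y; rewrite inE => yU; exact: heat_bath_lipschitz.
rewrite -mulr_sumr -mulrA ler_wpM2l // big_split /= mulrDl; apply: lerD.
  have E1 y : \sum_(x | (x != y) && (s x != t x)) w x =
      wdist s t - (if s y != t y then w y else 0).
    rewrite /wdist [in RHS](bigID (pred1 y)) /=.
    rewrite [X in _ = X + _ - _]big_mkcondl (big_pred1 y) //=.
    rewrite [X in X - _]addrC addrK; by apply: eq_bigl => x; exact: andbC.
  under eq_bigr do rewrite E1.
  rewrite sumrB sumr_const -mulr_natl mulrBl mul1r lerD2l lerN2.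
  rewrite -big_mkcondr /= /wdist le_eqVlt; apply/orP; left; apply/eqP.
  apply: eq_bigl => x; rewrite inE; have [xU|//] := boolP (x \in U).
  by rewrite (nu_pinned ns nt xU) eqxx.
rewrite exchange_big /= /wdist mulr_sumr; apply: ler_sum => x _.
apply: le_trans (w_kappa x); rewrite [leRHS](bigID [in ~: U]) /= lerDl.
by apply: sumr_ge0 => y _; rewrite mulr_ge0 ?dobrushin_ge0 // ltW.
Qed.

(** Minus the generator of the continuous-time heat-bath dynamics that updates
    each free site at rate [1]. *)
Definition generator h s : R :=
  free_sites * h s - \sum_(y in ~: U) heat_bath S y h s.

(** The Lipschitz bound is read off at a pair of configurations where the ratio
    of the increment of [h] to the distance is largest. *)
Lemma generator_lipschitz K c g h : 0 <= K -> lipschitz K g ->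
  (forall s, 0 < nu s -> generator h s = g s + c) ->
  lipschitz (K / (1 - kappa)) h.
Proof.
move=> K0 gK hg.
have k1 : 0 < 1 - kappa by rewrite subr_gt0.
pose P (p : config q V * config q V) := [&& 0 < nu p.1, 0 < nu p.2 & p.1 != p.2].
case: (pickP P) => [p0 Pp0|noP]; last first.
  move=> s t ns nt; have := noP (s, t); rewrite /P /= ns nt /= => /negbFE/eqP ->.
  by rewrite subrr normr0 mulr_ge0 ?wdist_ge0 // divr_ge0 // ltW.
pose ratio (p : config q V * config q V) := `|h p.1 - h p.2| / wdist p.1 p.2.
case: (@arg_maxP _ _ _ p0 P ratio Pp0) => -[s0 t0] /and3P[/= ns nt st0] max0.
set L := ratio (s0, t0) in max0.
have d0 := wdist_gt0 st0.
have L0 : 0 <= L by rewrite divr_ge0 // ltW.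
have hL : lipschitz L h.
  move=> s t ms mt; have [->|st] := eqVneq s t.
    by rewrite subrr normr0 mulr_ge0 ?wdist_ge0.
  rewrite -ler_pdivrMr ?wdist_gt0 //; apply: (max0 (s, t)).
  by rewrite /P /= ms mt.
have LE : `|h s0 - h t0| = L * wdist s0 t0.
  by rewrite /L /ratio /= divfK // gt_eqF.
have : free_sites * `|h s0 - h t0| <=
    (K + L * (free_sites - 1 + kappa)) * wdist s0 t0.
  have m0 : 0 <= free_sites by rewrite ler0n.
  rewrite -{1}(ger0_norm m0) -normrM.
  have -> : free_sites * (h s0 - h t0) = (g s0 - g t0) +
      \sum_(y in ~: U) (heat_bath S y h s0 - heat_bath S y h t0).
    have := hg _ ns; have := hg _ nt; rewrite /generator sumrB; lra.
  rewrite mulrDl; apply: le_trans (ler_normD _ _) _; apply: lerD; first exact: gK.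
  exact: sum_heat_bath_lipschitz.
rewrite LE mulrA ler_pM2r // => KL.
have LK : L <= K / (1 - kappa) by rewrite ler_pdivlMr //; lra.
move=> s t ms mt; apply: le_trans (hL s t ms mt) _.
by rewrite ler_wpM2r ?wdist_ge0.
Qed.

Lemma expect_generator nu' h :
  (forall y, y \notin U -> reversible_at S nu' y) ->
  (forall s, nu' s != 0 -> 0 < weight S s) ->
  \sum_s nu' s * generator h s = 0.
Proof.
move=> rev pos; rewrite /generator.
under eq_bigr do rewrite mulrBr mulr_sumr mulrCA.
rewrite sumrB exchange_big /= -mulr_sumr.
rewrite [X in _ - X](eq_bigr (fun=> \sum_s nu' s * h s)) => [|y]; last first.
  rewrite inE => yU; apply: expect_heat_bath; first exact: rev.
  by move=> s /pos; exact: weight_gt0_defined.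
by rewrite sumr_const -mulr_natl subrr.
Qed.

Lemma nu_neq0 s : (nu s != 0) = (0 < nu s).
Proof. by rewrite lt0r nu_ge0 andbT. Qed.

(** The mean of [h] under [nu]. *)
Definition expect h : R := \sum_s nu s * h s.

Lemma expect_lin c g h :
  expect (fun s => c * g s + h s) = c * expect g + expect h.
Proof.
rewrite /expect mulr_sumr -big_split; apply: eq_bigr => s _ /=.
by rewrite mulrDr mulrCA.
Qed.

Lemma expect_eq g h : (forall s, 0 < nu s -> g s = h s) -> expect g = expect h.
Proof.
move=> gh; apply: eq_bigr => s _.
by have [->|] := eqVneq (nu s) 0; [rewrite !mul0r|rewrite nu_neq0 => /gh ->].
Qed.

Lemma expect_cst c : expect (fun=> c) = c.
Proof. by rewrite /expect -mulr_suml nu_sum1 mul1r. Qed.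

Lemma generator_lin c g h s :
  generator (fun t => c * g t + h t) s = c * generator g s + generator h s.
Proof.
rewrite /generator; under eq_bigr do rewrite heat_bath_lin.
by rewrite big_split -mulr_sumr /=; ring.
Qed.

Lemma expect_generator0 h : expect (generator h) = 0.
Proof. by apply: expect_generator => // s; rewrite nu_neq0 => /nu_weight. Qed.

(** Adding the mean to the generator makes it injective on functions on the
    support, since the functions it kills are constant by the contraction. *)
Lemma poisson_equation K g : 0 <= K -> lipschitz K g ->
  exists h, (forall s, 0 < nu s -> generator h s = g s - expect g) /\
    lipschitz (K / (1 - kappa)) h.
Proof.
move=> K0 gK.
(* Off the support [A] is the identity, so that it acts on all functions. *)
pose A h s := if 0 < nu s then generator h s + expect h else h s.
have Amean h : expect (A h) = expect h.
  rewrite (@expect_eq _ (fun s => 1 * generator h s + expect h)) => [|s ns].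
    by rewrite expect_lin expect_generator0 mulr0 add0r expect_cst.
  by rewrite /A ns mul1r.
have Alin c f h s : A (fun t => c * f t + h t) s = c * A f s + A h s.
  rewrite /A; case: ifP => // _; rewrite generator_lin expect_lin; ring.
have Ainj h : (forall s, A h s = 0) -> forall s, h s = 0.
  move=> h0 s; have := h0 s; rewrite {1}/A; case: ifP => // ns _.
  have Eh : expect h = 0.
    by rewrite -Amean (@expect_eq _ (fun=> 0)) => [|t _]; rewrite ?expect_cst ?h0.
  have gen0 t : 0 < nu t -> generator h t = 0 + 0.
    by move=> nt; have := h0 t; rewrite /A nt Eh !addr0.
  have lip0 : lipschitz 0 (fun=> 0 : R).
    by move=> t u _ _; rewrite subrr normr0 mul0r.
  have hcst := generator_lipschitz (lexx 0) lip0 gen0.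
  rewrite -Eh -[LHS]expect_cst; apply: expect_eq => t nt.
  apply/eqP; rewrite -subr_eq0 -normr_le0.
  by have := hcst s t ns nt; rewrite !mul0r.
have [h hE] := injective_operator_surjective Alin Ainj (fun s => g s - expect g).
have Eh : expect h = 0.
  rewrite -Amean (@expect_eq _ (fun s => 1 * g s + - expect g)) => [|s _].
    by rewrite expect_lin expect_cst mul1r subrr.
  by rewrite hE mul1r.
have genh s : 0 < nu s -> generator h s = g s - expect g.
  by move=> ns; rewrite -hE /A ns Eh addr0.
by exists h; split=> //; exact: (generator_lipschitz K0 gK genh).
Qed.

(** Conditioning on the spin at [x] keeps the measure stationary for the updates
    at all other free sites, so only the update at [x] contributes to the mean
    of the generator under the conditioned measure. *)
Lemma expect_cond_diff K g x a : 0 <= K -> lipschitz K g -> x \notin U ->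
  0 < prob nu (has_spin x a) ->
  `|\sum_s cond nu (has_spin x a) s * g s - expect g| <=
    K / (1 - kappa) * w x.
Proof.
move=> K0 gK xU pxa; have [h [hE hL]] := poisson_equation K0 gK.
set nu' := cond nu (has_spin x a).
have nu'_ge0 s : 0 <= nu' s by exact: cond_ge0.
have nu'_gt0 s : nu' s != 0 -> 0 < nu s.
  move=> n0; have : 0 < nu' s by rewrite lt0r n0 nu'_ge0.
  by rewrite cond_gt0 // => /andP[].
have nu'_sum1 : \sum_s nu' s = 1 by exact: cond_sum1.
have L0 : 0 <= K / (1 - kappa) by rewrite divr_ge0 // subr_ge0 ltW.
set L := K / (1 - kappa) in hL L0 *.
have -> : \sum_s nu' s * g s - expect g =
    \sum_s nu' s * (h s - heat_bath S x h s).
  transitivity (\sum_s nu' s * generator h s).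
    rewrite -[X in _ - X]mul1r -nu'_sum1 mulr_suml -sumrB.
    apply: eq_bigr => s _; rewrite -mulrBr.
    by have [->|/nu'_gt0/hE ->] := eqVneq (nu' s) 0; rewrite ?mul0r.
  have xin : x \in ~: U by rewrite inE.
  have mE : free_sites * \sum_s nu' s * h s = \sum_(y in ~: U) \sum_s nu' s * h s.
    by rewrite sumr_const mulr_natl.
  rewrite /generator; under eq_bigr do rewrite mulrBr mulr_sumr mulrCA.
  rewrite sumrB exchange_big /= -mulr_sumr mE -sumrB (big_setD1 x xin) /=.
  rewrite [X in _ + X]big1 ?addr0 => [|y].
    by rewrite -sumrB; apply: eq_bigr => s _; rewrite mulrBr.
  rewrite !inE => /andP[yx yU]; rewrite expect_heat_bath ?subrr //.
    apply: cond_reversible; last exact: nu_rev.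
    by move=> s b; rewrite /has_spin update_other // eq_sym.
  by move=> s /nu'_gt0/nu_weight; exact: weight_gt0_defined.
apply: le_trans (ler_norm_sum _ _ _) _.
rewrite -[leRHS]mul1r -nu'_sum1 mulr_suml; apply: ler_sum => s _.
rewrite normrM (ger0_norm (nu'_ge0 s)).
have [->|/nu'_gt0 ns] := eqVneq (nu' s) 0; first by rewrite !mul0r.
rewrite ler_wpM2l //.
have ls1 : \sum_b local_cond S x s b = 1.
  exact/local_cond_sum1/weight_gt0_defined/nu_weight.
rewrite -[X in X - _]mul1r -ls1 mulr_suml -sumrB.
apply: le_trans (ler_norm_sum _ _ _) _.
rewrite -[leRHS]mul1r -ls1 mulr_suml; apply: ler_sum => b _.
rewrite -mulrBr normrM (ger0_norm (local_cond_ge0 S x s b)).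
have := local_cond_ge0 S x s b; rewrite le0r => /orP[/eqP->|lb].
  by rewrite !mul0r.
rewrite ler_pM2l //; apply: le_trans (hL _ _ ns (update_supp xU ns lb)) _.
by rewrite ler_wpM2l // wdist_update.
Qed.

End Contraction.

(** * Eigenvalues of the influence matrix *)

Section PinnedGibbs.
Variables (R : realType) (q : nat) (V dV : finType).
Variable S : spin_system R q V dV.
Hypothesis tc : totally_connected (gibbs S).
Variables (w : V -> R) (kappa : R).
Hypothesis w_gt0 : forall x, 0 < w x.
Hypothesis kappa_lt1 : kappa < 1.
Hypothesis w_kappa : forall x, \sum_y dobrushin S x y * w y <= kappa * w x.

Lemma influence_eigenvalue_le (U : {set V}) (t : config q V) (lambda : R) :
  pinning (gibbs S) U t ->
  eigenvalue (influence_mx (gibbs S) U t) lambda -> lambda <= 2 / (1 - kappa).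
Proof.
move=> /existsP[s0 /andP[]]; rewrite inE => ms0 As0 /eigenvalue_mx_on.
set nu := pinned (gibbs S) U t; set X := site_spins _ _ _.
case=> f [f0 [p0 p0X fp0] fE].
have mu_ge0 := gibbs_ge0 S.
have nu_ge0 s : 0 <= nu s by exact: cond_ge0.
have nu_gt0 s : (0 < nu s) = agree_on U t s && (0 < weight S s).
  by rewrite /nu cond_gt0 // gibbs_gt0.
have nu_sum1 : \sum_s nu s = 1 by apply: cond_sum1; exact: prob_gt0 As0 ms0.
have nu_weight s : 0 < nu s -> 0 < weight S s by rewrite nu_gt0 => /andP[].
have nu_rev y : y \notin U -> reversible_at S nu y.
  move=> yU; apply: cond_reversible; last exact/scale_reversible/weight_reversible.
  move=> s a; apply: eq_forallb_in => z zU.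
  by rewrite update_other //; apply: contraNneq yU => <-.
have nu_pinned s u : 0 < nu s -> 0 < nu u -> forall z, z \in U -> s z = u z.
  rewrite !nu_gt0 => /andP[/forall_inP ss _] /andP[/forall_inP su _] z zU.
  by rewrite (eqP (ss z zU)) (eqP (su z zU)).
pose ratio (p : V * 'I_q) := `|f p| / w p.1.
case: (@arg_maxP _ _ _ p0 [in X] ratio p0X) => -[x a] /= xaX max0.
set M := ratio (x, a) in max0.
have M0 : 0 < M.
  apply: lt_le_trans (max0 p0 p0X); rewrite divr_gt0 // normr_gt0 //.
have fM p : `|f p| <= M * w p.1.
  have [pX|pX] := boolP (p \in X); last by rewrite f0 // normr0 mulr_ge0 // ltW.
  by rewrite -ler_pdivrMr //; exact: max0.
have fxa : `|f (x, a)| = M * w x by rewrite /M /ratio /= divfK // gt_eqF.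
pose g (s : config q V) := \sum_(y | y != x) f (y, s y).
have gL : lipschitz w nu (2 * M) g.
  move=> s u _ _; rewrite /g -sumrB; apply: le_trans (ler_norm_sum _ _ _) _.
  rewrite /wdist mulr_sumr [leRHS]big_mkcond [leLHS]big_mkcond /=.
  apply: ler_sum => y _; have w0 := ltW (w_gt0 y).
  case: (eqVneq (s y) (u y)) => [->|_]; first by rewrite subrr normr0 if_same.
  case: ifP => _; last by rewrite mulr_ge0 // mulr_ge0 // ltW.
  apply: le_trans (ler_normB _ _) _.
  by have := fM (y, s y); have := fM (y, u y); rewrite /=; lra.
move: (xaX); rewrite inE /= => /andP[xU pxa].
have M20 : 0 <= 2 * M by rewrite mulr_ge0 // ltW.
have := expect_cond_diff tc w_gt0 kappa_lt1 w_kappa nu_ge0 nu_sum1 nu_weight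
  nu_rev nu_pinned M20 gL xU pxa.
have -> : \sum_s cond nu (has_spin x a) s * g s - expect nu g = lambda * f (x, a).
  rewrite -fE // /expect /g.
  under eq_bigr do rewrite mulr_sumr.
  under [X in _ - X]eq_bigr do rewrite mulr_sumr.
  rewrite exchange_big [X in _ - X]exchange_big -sumrB /=.
  (* Both means are sums over the sites [y != x] of the means of [f (y, s y)]. *)
  under eq_bigr => y yx.
    rewrite -(prob_has_spin_sum _ (fun b => f (y, b))).
    rewrite -(prob_has_spin_sum _ (fun b => f (y, b))) -sumrB.
    under eq_bigr do rewrite -mulrBl.
    over.
  rewrite (big_mkcond [in X]) /= [RHS](eq_bigr (fun p : V * 'I_q =>
    influence (gibbs S) U t (x, a) (p.1, p.2) * f (p.1, p.2))); last first.
    by case=> y b _; case: ifPn => // pX; rewrite f0 // mulr0.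
  rewrite -(pair_bigA _ (fun y b => influence (gibbs S) U t (x, a) (y, b) * f (y, b))) /=.
  rewrite [LHS]big_mkcond; apply: eq_bigr => y _.
  rewrite /influence /= eq_sym; case: eqP => //= _.
  by rewrite big1 // => b _; rewrite mul0r.
rewrite normrM fxa mulrA mulrAC => h.
apply: le_trans (ler_norm _) _.
have Mw : 0 < M * w x by rewrite mulr_gt0.
rewrite -(ler_pM2r Mw).
move: h; lra.
Qed.

End PinnedGibbs.

(** The matrix [dobrushin_mx S] is indexed by ordinals; the weights are
    transported to the sites. *)
Lemma dobrushin_weights (R : realType) (q : nat) (V dV : finType)
    (S : spin_system R q V dV) (kappa : R) :
  spectral_radius (dobrushin_mx S) < kappa ->
  exists w : V -> R, (forall x, 0 < w x) /\
    forall x, \sum_y dobrushin S x y * w y <= kappa * w x.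
Proof.
move=> rho; have [|w [w_gt0 wE]] := @positive_weights _ _ _ _ kappa rho.
  by move=> i j; rewrite mxE dobrushin_ge0.
pose r (x : V) : 'I_#|[set: V]| := enum_rank_in (in_setT x) x.
have rK x : enum_val (r x) = x by rewrite enum_rankK_in ?inE.
have rE i : r (enum_val i) = i by apply: enum_val_inj; rewrite rK.
exists (fun x => w (r x)); split=> // x.
apply: le_trans (wE (r x)); rewrite le_eqVlt; apply/orP; left; apply/eqP.
rewrite (eq_bigl [in [set: V]]) => [|y]; last by rewrite inE.
by rewrite big_enum_val; apply: eq_bigr => j _; rewrite mxE rK rE.
Qed.

Theorem theorem1p13 (R : realType) (q : nat) (V dV : finType)
    (S : spin_system R q V dV) (eps : R) :
  (2 <= q)%N ->
  Omega S != set0 ->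
  totally_connected (gibbs S) ->
  0 < eps ->
  spectral_radius (dobrushin_mx S) <= 1 - eps ->
  spectrally_independent (gibbs S) (2 / eps).
Proof.
move=> _ _ tc eps0 rho U t pin; apply: largest_eigenvalue_le => [|lambda ev].
  by rewrite divr_ge0 // ltW.
rewrite leNgt; apply/negP => lt_lambda.
have lambda0 : 0 < lambda by apply: lt_trans lt_lambda; rewrite divr_gt0.
(* If [2 / eps < lambda], then [kappa] is taken with [1 - kappa] halfway between
   [2 / lambda] and [eps]. *)
have : 2 / lambda < eps by rewrite ltr_pdivrMr // mulrC -ltr_pdivrMr.
set d := 2 / lambda => d_eps.
have d0 : 0 < d by rewrite divr_gt0.
pose kappa := 1 - (d + eps) / 2.
have [|w [w_gt0 wE]] := @dobrushin_weights _ _ _ _ S kappa.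
  by apply: le_lt_trans rho _; rewrite /kappa; lra.
have kappa1 : kappa < 1 by rewrite /kappa; lra.
have := influence_eigenvalue_le tc w_gt0 kappa1 wE pin ev.
rewrite leNgt => /negP[]; rewrite ltr_pdivrMr ?subr_gt0 // mulrC.
by rewrite -ltr_pdivrMr // -/d /kappa; lra.
Qed.
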